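(* Let $d\ge 1$, let $M\in\mathbb{R}^{d\times d}$ satisfy $M+M^\top\succeq 0$, and let $q\in\mathbb{R}^d$. Define the single-valued operator $\mathcal{F}:\mathbb{R}^d\times\mathbb{R}_{++}\to\mathbb{R}^{d+1}$ by $$\mathcal{F}(z,\tau)=\begin{bmatrix} Mz+q\tau\\ -z^\top Mz/\tau - z^\top q\end{bmatrix}.$$ Then $\mathcal{F}$ is monotone, i.e., $(\mathcal{F}(u)-\mathcal{F}(w))^\top(u-w)\ge 0$ for all $u,w\in\mathbb{R}^d\times\mathbb{R}_{++}$.
   Context: $\mathbb{R}_{++}$ denotes the set of strictly positive reals. $M+M^\top\succeq 0$ means that the symmetric matrix $M+M^\top$ is positive semidefinite. *)

(* Defs.v *)
From mathcomp Require Import all_boot all_order all_algebra.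
From mathcomp Require Import reals interval_inference.

Set Implicit Arguments.
Unset Strict Implicit.
Unset Printing Implicit Defensive.

Import GRing.Theory Num.Theory.

Local Open Scope ring_scope.

Definition psd (R : realType) (n : nat) (A : 'M[R]_n) : Prop :=
  A^T = A /\ forall x : 'cV[R]_n, 0 <= (x^T *m A *m x) 0 0.

(* The domain R^d x R_{++}; [{posnum R}] is the type of reals [t] with [0 < t]. *)
Definition dom (R : realType) (d : nat) : Type := ('cV[R]_d * {posnum R})%type.

(* The inclusion of R^d x R_{++} in R^(d+1), where differences and inner
   products are taken. *)
Definition dom_vec (R : realType) (d : nat) (u : dom R d) : 'cV[R]_(d + 1) :=
  col_mx u.1 (u.2%:num)%:M.

Definition calF (R : realType) (d : nat) (M : 'M[R]_d) (q : 'cV[R]_d)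
    (u : dom R d) : 'cV[R]_(d + 1) :=
  let z := u.1 in
  let tau := u.2%:num in
  col_mx (M *m z + tau *: q)
         (- (z^T *m M *m z) 0 0 / tau - (z^T *m q) 0 0)%:M.

Definition monotone (R : realType) (d : nat)
    (F : dom R d -> 'cV[R]_(d + 1)) : Prop :=
  forall u w : dom R d, 0 <= ((F u - F w)^T *m (dom_vec u - dom_vec w)) 0 0.

(* Main.v *)
(** With [x := z / t - w / s], the [q] terms cancel and
    [(F(z,t) - F(w,s))^T ((z,t) - (w,s)) = t s x^T M x], which is nonnegative
    because [2 x^T M x = x^T (M + M^T) x]. *)
Require Import Defs.
From mathcomp Require Import all_boot all_order all_algebra.
From mathcomp Require Import reals interval_inference.
From mathcomp Require Import ring.

Import GRing.Theory Num.Theory.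

Local Open Scope ring_scope.

(** Each [F u] is orthogonal to [u], so only the cross terms remain. With [a = z/t] and [b = y/s]
    they are [t s (a-b)^T (M a + q)] and [t s (b-a)^T (M b + q)]; adding them cancels [q] and leaves
    the form of [M] at [a - b] ([calF_inner]), which [psd_sym_quad_ge0] bounds below. *)

Lemma dotmxC (R : comPzRingType) (d : nat) (x y : 'cV[R]_d) :
  x^T *m y = y^T *m x.
Proof.
by rewrite -[x in RHS]trmxK -trmx_mul; apply/matrixP=> i j; rewrite !ord1 [RHS]mxE.
Qed.

(** A 1x1 product equals its transpose, so [M^T] has the same quadratic form as [M]. *)
Lemma psd_sym_quad_ge0 (R : realType) (d : nat) (M : 'M[R]_d) (x : 'cV[R]_d) :
  psd (M + M^T) -> 0 <= (x^T *m M *m x) 0 0.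
Proof.
case=> _ /(_ x); rewrite mulmxDr mulmxDl mxE.
have -> : x^T *m M^T *m x = x^T *m M *m x.
  by rewrite -trmx_mul dotmxC mulmxA.
by rewrite -mulr2n pmulrn_lge0.
Qed.

Lemma calF_inner (R : realType) (d : nat) (M : 'M[R]_d) (q : 'cV[R]_d)
    (u w : dom R d) :
  let t := u.2%:num in let s := w.2%:num in
  let x := t^-1 *: u.1 - s^-1 *: w.1 in
  ((calF M q u - calF M q w)^T *m (dom_vec u - dom_vec w)) 0 0 =
  t * s * (x^T *m M *m x) 0 0.
Proof.
case: u w => [z t] [y s] /=.
have t0 : t%:num != 0 by [].
have s0 : s%:num != 0 by [].
rewrite /calF /dom_vec /= !opp_col_mx !add_col_mx tr_col_mx mul_row_col.
rewrite -!raddfB /= tr_scalar_mx -scalar_mxM.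
have -> : M *m z + t%:num *: q - (M *m y + s%:num *: q) =
    M *m (z - y) + (t%:num - s%:num) *: q.
  by rewrite mulmxBr scalerBl opprD addrACA.
(* Swapping the factors avoids transposing [M] in the expansion. *)
rewrite mxE dotmxC.
rewrite !(mulmxDr, linearB, linearZ) /= !mulmxA.
rewrite !(mulmxDl, mulNmx, mulmxN) -?(scalemxAl, scalemxAr) !mulNmx.
(* As atoms, these products leave a rational identity in [t] and [s]; [zy] and [yz] stay distinct
   since [M] may be asymmetric. *)
move: (z^T *m M *m z) (z^T *m M *m y) (y^T *m M *m z) (y^T *m M *m y)
  (z^T *m q) (y^T *m q) => zz zy yz yy zq yq.
rewrite !mxE /= mulr1n.
by field; rewrite t0 s0.
Qed.

Theorem lemma4p1 (R : realType) (d : nat) (hd : (1 <= d)%N)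
    (M : 'M[R]_d) (hM : psd (M + M^T)) (q : 'cV[R]_d) :
  monotone (calF M q).
Proof.
move=> u w; rewrite calF_inner; apply: mulr_ge0 => //.
exact: psd_sym_quad_ge0.
Qed.
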